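(* Let $G=(V,E)$ be a connected $d$-regular bipartite graph and let $k\in\mathbb{R}$ be such that $\kappa(v_1,v_2)\geq k$ for every pair of distinct vertices $v_1,v_2\in V$. Fix $x\in V$ and for $i\ge0$ let $S_i=\{v\in V:\mathrm{dist}(x,v)=i\}$. Then for every $i\geq 1$, $$|S_{i+1}|\leq \frac{d-dk}{2}\,|S_i|.$$
   Context: $\mathrm{dist}$ is the graph distance. For a vertex $x$ of degree $d_x$, $\mu_x$ is the probability measure on $V$ with $\mu_x(x)=\tfrac12$, $\mu_x(v)=\tfrac{1}{2d_x}$ if $v\sim x$, and $\mu_x(v)=0$ otherwise. For probability measures $\mu,\nu$ of finite support, $W_1(\mu,\nu)=\inf_m\sum_{u,v}\mathrm{dist}(u,v)\,m(u,v)$, the infimum over couplings $m$ of $\mu$ and $\nu$. The Ollivier curvature of distinct vertices $x,y$ is $\kappa(x,y)=1-\frac{W_1(\mu_x,\mu_y)}{\mathrm{dist}(x,y)}$. *)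

(* Defs.v *)
From HB Require Import structures.
From mathcomp Require Export all_boot all_order all_algebra finmap.
From mathcomp Require Export boolp classical_sets functions cardinality fsbigop.
From mathcomp Require Export reals.

Set Implicit Arguments.
Unset Strict Implicit.
Unset Printing Implicit Defensive.

Export Order.TTheory GRing.Theory Num.Theory.
Local Open Scope classical_set_scope.
Local Open Scope ring_scope.

(* A simple graph is a vertex type V, finite or infinite, with a symmetric and
   irreflexive adjacency relation e. *)
Section Graph.
Variables (V : choiceType) (e : rel V).

Definition nbr (v : V) : set V := [set w | e v w].

Definition degree (v : V) : nat := #|` fset_set (nbr v)|.

(* The finiteness clause is needed because fset_set is empty on infinite
   sets. *)
Definition regular_graph (d : nat) : Prop :=
  forall v, finite_set (nbr v) /\ degree v = d.

Definition is_walk (u v : V) (n : nat) : Prop :=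
  exists p : seq V, [/\ path e u p, last u p = v & size p = n].

Definition connected_graph : Prop := forall u v, exists n, is_walk u v n.

Definition bipartite_graph : Prop :=
  exists side : V -> bool, forall u v, e u v -> side u != side v.

(* The value 0 for vertices not joined by a walk is never reached in a
   connected graph. *)
Definition dist (u v : V) : nat :=
  if pselect (exists n, `[< is_walk u v n >]) is left h then ex_minn h else 0%N.

Definition sphere (x : V) (i : nat) : set V := [set v | dist x v = i].

(* Hence #|` fset_set (sphere x i)| is the true cardinality of the sphere. *)
Lemma finite_sphere (d : nat) (x : V) (i : nat) :
  connected_graph -> regular_graph d -> finite_set (sphere x i).
Proof.
move=> conn reg; apply: (@sub_finite_set _ _ [set v | is_walk x v i]).
  move=> v <-; rewrite /= /dist; case: pselect => [h|[]].
    by case: ex_minnP => n /asboolP.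
  by have [n xv] := conn x v; exists n; apply/asboolP.
elim: i => [|i IH].
  by apply: sub_finite_set (finite_set1 x) => v [[|a p] []].
apply: sub_finite_set (bigcup_finite IH (fun u _ => (reg u).1)).
move=> v [p]; case/lastP: p => [|p w] [] //.
rewrite rcons_path last_rcons size_rcons => /andP[xp pw] <- [<-].
by exists (last x p) => //; exists p.
Qed.

End Graph.

Section Curvature.
Variables (R : realType) (V : choiceType) (e : rel V).

Definition mu (x v : V) : R :=
  if v == x then 2^-1 else if e x v then (2 * (degree e x)%:R)^-1 else 0.

(* A coupling of two finitely supported measures vanishes outside the product
   of their supports, so asking for finite support excludes no coupling; it is
   stated because \sum_(i \in A) is 0 on infinitely supported families. *)
Definition coupling (p q : V -> R) (m : V * V -> R) : Prop :=
  [/\ forall z, 0 <= m z,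
      finite_set [set z | m z != 0],
      forall u, \sum_(v \in [set: V]) m (u, v) = p u &
      forall v, \sum_(u \in [set: V]) m (u, v) = q v].

Definition cost (m : V * V -> R) : R :=
  \sum_(z \in [set: V * V]) (dist e z.1 z.2)%:R * m z.

Definition W1 (p q : V -> R) : R := inf [set cost m | m in coupling p q].

Definition kappa (x y : V) : R := 1 - W1 (mu x) (mu y) / (dist e x y)%:R.

End Curvature.

(* Main.v *)
(* Call [w] in S_(i+1) a private child of [v] in S_i if [v] is its only
   neighbour in S_i. Every vertex of S_(i+1) has two neighbours in S_i or is the
   private child of one, so counting edges between the two spheres, and once
   more those to private children, gives at least 2 |S_(i+1)|. A vertex [v] of
   S_i has at most d - 1 neighbours in S_(i+1), because it has a neighbour [y]
   in S_(i-1). Finally [v] has at most 1 - d k private children: bipartiteness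
   puts them at distance 3 from all neighbours of [y] other than [v], so the
   potential equal to 2 on them, 1 at [v], -1 on the other neighbours of [y] and
   0 elsewhere bounds W_1(mu_v, mu_y) from below. *)

Require Import Defs.
From mathcomp Require Import zify ring lra.
Local Open Scope classical_set_scope.
Local Open Scope ring_scope.

Set Implicit Arguments.
Unset Strict Implicit.
Unset Printing Implicit Defensive.

(** * Walks, graph distance and parity *)

Section Distance.
Variables (V : choiceType) (e : rel V).
Hypothesis conn : connected_graph e.

Lemma dist_walk (u v : V) : is_walk e u v (dist e u v).
Proof.
rewrite /dist; case: pselect => [h|[]]; first by case: ex_minnP => n /asboolP.
by have [n uv] := conn u v; exists n; apply/asboolP.
Qed.

Lemma dist_le_walk (u v : V) (n : nat) : is_walk e u v n -> (dist e u v <= n)%N.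
Proof.
rewrite /dist => uv; case: pselect => // h; case: ex_minnP => m _; apply.
exact/asboolP.
Qed.

Lemma dist_eq0 (u v : V) : dist e u v = 0%N -> u = v.
Proof. by move=> d0; have := dist_walk u v; rewrite d0 => -[p [_ <- /size0nil ->]]. Qed.

Lemma dist_triangle (u v w : V) : (dist e u w <= dist e u v + dist e v w)%N.
Proof.
have [p [pp <- <-]] := dist_walk u v.
have [q [qq <- <-]] := dist_walk (last u p) w.
by apply: dist_le_walk; exists (p ++ q); rewrite cat_path pp last_cat size_cat.
Qed.

Lemma dist_sym (u v : V) : symmetric e -> dist e u v = dist e v u.
Proof.
move=> e_sym; suff le a b : (dist e a b <= dist e b a)%N.
  by apply/eqP; rewrite eqn_leq !le.
have [p [pp <- <-]] := dist_walk b a; apply: dist_le_walk.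
exists (rev (belast b p)); split; last by rewrite size_rev size_belast.
  by rewrite rev_path; rewrite (eq_path (e' := e)).
by case: p {pp} => //= c p; rewrite rev_cons last_rcons.
Qed.

Lemma dist_edge_le (u v : V) : e u v -> (dist e u v <= 1)%N.
Proof. by move=> uv; apply: dist_le_walk; exists [:: v]; rewrite /= uv. Qed.

(** Cut the last edge off a shortest walk: its penultimate vertex cannot be closer than [n] by the
    triangle inequality. *)
Lemma dist_pred (x v : V) (n : nat) :
  dist e x v = n.+1 -> exists2 y, e y v & dist e x y = n.
Proof.
move=> xv; have [p []] := dist_walk x v; rewrite xv.
case/lastP: p => // p w; rewrite rcons_path last_rcons size_rcons.
move=> /andP[xp pw] wv [pn]; rewrite {w}wv in pw; exists (last x p) => //.
have le1 : (dist e x (last x p) <= n)%N by apply: dist_le_walk; exists p.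
have := dist_triangle x (last x p) v; have := dist_edge_le pw; lia.
Qed.

(** Every edge of a shortest walk switches sides. *)
Lemma odd_dist (side : V -> bool) (u v : V) :
  (forall a b, e a b -> side a != side b) ->
  odd (dist e u v) = (side u != side v).
Proof.
move=> sideP; have [p [pp <- <-]] := dist_walk u v.
elim: p u pp => [|a p IH] u /=; first by rewrite eqxx.
move=> /andP[/sideP ua ap]; rewrite (IH a ap).
by case: (side u) (side a) (side (last a p)) ua => [] [] [].
Qed.

End Distance.

(** * Couplings and lower bounds for the transport cost *)

Section Transport.
Variables (R : realType) (V : choiceType) (e : rel V).

Lemma coupling_eq0 (p q : V -> R) (m : V * V -> R) (u v : V) :
  coupling p q m -> p u = 0 \/ q v = 0 -> m (u, v) = 0.
Proof.
move=> [m0 mfin mp mq] pq0.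
(* Without finite support the marginal sums could be 0 by default, and a nonzero entry would
   contradict nothing. *)
have fin1 : finite_set [set w | m (u, w) != 0].
  by apply: sub_finite_set (finite_image snd mfin) => w mw; exists (u, w).
have fin2 : finite_set [set w | m (w, v) != 0].
  by apply: sub_finite_set (finite_image fst mfin) => w mw; exists (w, v).
apply/eqP/negP => /negP muv.
have sum_gt0 (h : V -> R) w : (forall z, 0 <= h z) ->
    finite_set [set z | h z != 0] -> h w != 0 -> \sum_(z \in [set: V]) h z != 0.
  move=> h0 hfin hw; rewrite (fsbigTE (fset_set [set z | h z != 0])); last first.
    by move=> z; rewrite in_fset_set// notin_setE /= => /negP; rewrite negbK => /eqP.
  rewrite (big_fsetD1 w) /=; last by rewrite in_fset_set// inE.
  by rewrite gt_eqF// ltr_pwDl ?sumr_ge0// lt0r hw h0.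
case: pq0 => [pu0|qv0].
  by have /eqP := sum_gt0 (fun w => m (u, w)) v (fun z => m0 _) fin1 muv; rewrite mp.
by have /eqP := sum_gt0 (fun w => m (w, v)) u (fun z => m0 _) fin2 muv; rewrite mq.
Qed.

(** Provides a coupling, so that the infimum in [W1] is not taken over the empty set, where it would
    be a default value. *)
Lemma product_coupling (p q : V -> R) (P Q : {fset V}) :
  (forall u, 0 <= p u) -> (forall v, 0 <= q v) ->
  (forall u, u \notin P -> p u = 0) -> (forall v, v \notin Q -> q v = 0) ->
  \sum_(u <- P) p u = 1 -> \sum_(v <- Q) q v = 1 ->
  coupling p q (fun z => p z.1 * q z.2).
Proof.
move=> p0 q0 pP qQ p1 q1; split.
- by move=> z; rewrite mulr_ge0.
- apply: sub_finite_set (finite_setX (finite_fset P) (finite_fset Q)).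
  move=> [u v] /= puqv; split.
    by apply: contraT => /pP z0; rewrite z0 mul0r eqxx in puqv.
  by apply: contraT => /qQ z0; rewrite z0 mulr0 eqxx in puqv.
- by move=> u /=; rewrite -mulr_fsumr (fsbigTE Q) ?q1 ?mulr1.
- by move=> v /=; rewrite -mulr_fsuml (fsbigTE P) ?p1 ?mul1r.
Qed.

(* The easy half of Kantorovich duality, for a potential [f] that need only be
   1-Lipschitz between the two supports. *)
Lemma W1_ge (p q f : V -> R) (P Q : {fset V}) :
  (forall u, 0 <= p u) -> (forall v, 0 <= q v) ->
  (forall u, u \notin P -> p u = 0) -> (forall v, v \notin Q -> q v = 0) ->
  \sum_(u <- P) p u = 1 -> \sum_(v <- Q) q v = 1 ->
  (forall u v, u \in P -> v \in Q -> f u - f v <= (dist e u v)%:R) ->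
  \sum_(u <- P) f u * p u - \sum_(v <- Q) f v * q v <= W1 e p q.
Proof.
move=> p0 q0 pP qQ p1 q1 fdist; apply: lb_le_inf.
  exists (cost e (fun z => p z.1 * q z.2)).
  by exists (fun z => p z.1 * q z.2) => //; apply: product_coupling p1 q1.
move=> _ [m cm <-].
have mP u v : u \notin P -> m (u, v) = 0.
  by move=> /pP ?; apply: coupling_eq0 cm _; left.
have mQ u v : v \notin Q -> m (u, v) = 0.
  by move=> /qQ ?; apply: coupling_eq0 cm _; right.
have [m0 _ mp mq] := cm.
have -> : cost e m = \sum_(u <- P) \sum_(v <- Q) (dist e u v)%:R * m (u, v).
  rewrite fsbig_seq ?fset_uniq//.
  under eq_fsbigr do rewrite fsbig_seq ?fset_uniq//.
  rewrite pair_fsbig; try exact: finite_fset.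
  rewrite /cost; apply/esym.
  under eq_fsbigr => z _ do rewrite -surjective_pairing.
  apply: fsbig_widen => // -[u v] [_ /= /not_andP[]] /negP uv.
    by rewrite mP ?mulr0.
  by rewrite mQ ?mulr0.
(* The marginal conditions turn both integrals of [f] into double sums against [m], which are then
   compared with the cost term by term. *)
have -> : \sum_(u <- P) f u * p u = \sum_(u <- P) \sum_(v <- Q) f u * m (u, v).
  by apply: eq_bigr => u _; rewrite -mp (fsbigTE Q) ?mulr_sumr// => v /mQ.
have -> : \sum_(v <- Q) f v * q v = \sum_(u <- P) \sum_(v <- Q) f v * m (u, v).
  rewrite exchange_big /=; apply: eq_bigr => v _.
  by rewrite -mq (fsbigTE P) ?mulr_sumr// => u /mP.
rewrite -sumrB big_seq [leRHS]big_seq; apply: ler_sum => u uP.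
rewrite -sumrB big_seq [leRHS]big_seq; apply: ler_sum => v vQ.
by rewrite -mulrBl ler_wpM2r// fdist.
Qed.

End Transport.

(** * Lazy random walk measures on a regular graph *)

Section RandomWalk.
Variables (R : realType) (V : choiceType) (e : rel V) (d : nat).
Hypotheses (e_irr : irreflexive e) (reg : regular_graph e d) (d_gt0 : (0 < d)%N).

Let N (x : V) : {fset V} := fset_set (nbr e x).

Lemma in_nbr (x v : V) : (v \in N x) = e x v.
Proof.
rewrite /N in_fset_set; last exact: (reg x).1.
by apply/idP/idP; rewrite inE.
Qed.

Lemma card_nbr (x : V) : #|` N x| = d.
Proof. exact: (reg x).2. Qed.

Lemma mu_ge0 (x v : V) : 0 <= mu R e x v.
Proof. by rewrite /mu; do 2?case: ifP => // _; rewrite invr_ge0 ?mulr_ge0. Qed.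

Lemma mu_eq0 (x v : V) : v \notin (x |` N x)%fset -> mu R e x v = 0.
Proof. by rewrite in_fset1U in_nbr negb_or /mu => /andP[/negPf-> /negPf->]. Qed.

Lemma sum_mu (f : V -> R) (x : V) :
  \sum_(v <- (x |` N x)%fset) f v * mu R e x v =
  f x / 2 + (\sum_(v <- N x) f v) / (2 * d%:R).
Proof.
rewrite big_fsetU1 ?in_nbr ?e_irr//= {1}/mu eqxx mulr_suml; congr (_ + _).
rewrite big_seq [RHS]big_seq; apply: eq_bigr => v; rewrite in_nbr /mu => xv.
case: eqP xv => [->|_ ->]; first by rewrite e_irr.
by rewrite (reg x).2.
Qed.

Lemma sum_mu1 (x : V) : \sum_(v <- (x |` N x)%fset) mu R e x v = 1.
Proof.
under eq_bigr do rewrite -[mu _ _ _ _]mul1r.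
rewrite sum_mu big_const_seq count_predT iter_addr addr0 card_nbr.
have : d%:R != 0 :> R by rewrite pnatr_eq0; lia.
by move=> ?; field.
Qed.

End RandomWalk.

Lemma sum_nat_of_pred (T : choiceType) (A : {fset T}) (b : pred T) :
  (\sum_(w <- A) b w)%N = #|` [fset w in A | b w]%fset|.
Proof.
rewrite card_fset_sum1 -big_fset_condE [RHS]big_mkcond /=.
by apply: eq_bigr => w _; case: (b w).
Qed.

(** * Private children and the edge count between spheres *)

Section PrivateChildren.
Variables (R : realType) (V : choiceType) (e : rel V) (d : nat) (x : V).
Hypotheses (e_sym : symmetric e) (e_irr : irreflexive e).
Hypotheses (conn : connected_graph e) (reg : regular_graph e d).
Hypothesis bip : bipartite_graph e.

Local Notation level := (dist e x).
Local Notation N v := (fset_set (nbr e v)).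

Definition private_child (v w : V) : bool :=
  [&& e v w, level w == (level v).+1 &
      `[< forall v', e v' w -> level v' = level v -> v' = v >]].

Definition private_children (v : V) : {fset V} :=
  [fset w in N v | private_child v w]%fset.

Lemma level_edge (u v : V) : e u v -> (level v <= (level u).+1)%N.
Proof.
move=> uv; have := dist_triangle conn x u v; have := dist_edge_le uv; lia.
Qed.

Lemma no_triangle (u v w : V) : e u v -> e u w -> e v w = false.
Proof.
have [side sideP] := bip => /sideP uv /sideP uw; apply/negP => /sideP vw.
by case: (side u) (side v) (side w) uv uw vw => [] [] [].
Qed.

Lemma dist_edge (u v : V) : e u v -> dist e u v = 1%N.
Proof.
move=> uv; have := dist_edge_le uv.
case duv: (dist e u v) => [|[]]// _; move: uv.
by rewrite (dist_eq0 conn duv) e_irr.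
Qed.

(** With U private children, the potential has mean 1/2 + U/d under mu_v and 1/d - 1/2 under mu_y.
    Since [v] and [y] are adjacent, W_1 is at most 1 - k, so 1 + (U - 1)/d <= 1 - k. *)
Lemma card_private_children (k : R) (v y : V) :
  e y v -> level v = (level y).+1 -> k <= kappa R e v y ->
  #|` private_children v|%:R <= 1 - d%:R * k :> R.
Proof.
move=> yv lv kvy; have vy : e v y by rewrite e_sym.
have d_gt0 : (0 < d)%N.
  rewrite -(card_nbr reg v) cardfs_gt0; apply/fset0Pn; exists y.
  by rewrite (in_nbr reg).
have [side sideP] := bip.
have dist_parity a b := odd_dist conn a b sideP.
(* The test [z == v] precedes [e y z] because [v] is itself a neighbour of [y]. *)
pose f z : R := if private_child v z then 2 else
  if z == v then 1 else if e y z then -1 else 0.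
have fv : f v = 1 by rewrite /f /private_child e_irr eqxx.
have not_private z : (level z <= level v)%N -> private_child v z = false.
  by move=> lz; apply/negP => /and3P[_ /eqP]; lia.
have fy : f y = 0.
  rewrite /f not_private; last by lia.
  by rewrite e_irr; case: eqP vy => // ->; rewrite e_irr.
(* The value -1 does not occur here, since a common neighbour of [v] and [y] would close a
   triangle. *)
have fNv z : e v z -> f z = 2 * (private_child v z)%:R.
  rewrite /f; case: ifP => _ vz; first by rewrite mulr1.
  rewrite (no_triangle vy vz) mulr0.
  by case: eqP vz => // ->; rewrite e_irr.
have fNy z : e y z -> f z = -1 + 2 * (z == v)%:R.
  move=> yz; rewrite /f not_private ?yz; last by rewrite lv; apply: level_edge.
  by case: eqP => _ /=; lra.
have flip a b : a \in (v |` N v)%fset -> b \in (y |` N y)%fset ->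
    f a - f b <= (dist e a b)%:R.
  rewrite !in_fset1U !(in_nbr reg) => Pa Pb.
  have [b_v|b_v] := eqVneq b v.
    rewrite b_v fv; case/orP: Pa => [/eqP->|va]; first by rewrite fv subrr.
    rewrite dist_edge 1?e_sym// fNv//.
    by case: private_child; rewrite /=; lra.
  (* If [b] is [y], only private children matter: they lie two levels above [y], hence at distance
     at least 2. *)
  case/orP: Pb => [/eqP by_|yb].
    rewrite by_ fy subr0; case/orP: Pa => [/eqP->|va].
      by rewrite fv dist_edge.
    rewrite fNv//; case Ua : (private_child v a); last by rewrite mulr0.
    rewrite mulr1 ler_nat; have /and3P[_ /eqP la _] := Ua.
    have := dist_triangle conn x y a.
    by rewrite (dist_sym conn y a e_sym); lia.
  (* Now [f b] is -1, and [b] lies on the side of [v]. So the distance from [v] to [b] is even and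
     nonzero, hence at least the required 2. *)
  have side_vb : side v = side b.
    move: (sideP _ _ yv) (sideP _ _ yb).
    by case: (side v) (side b) (side y) => [] [] [].
  rewrite (fNy b yb) (negPf b_v) mulr0 addr0 opprK.
  case/orP: Pa => [/eqP->|va].
    have := dist_parity v b; rewrite fv side_vb eqxx /=.
    case dvb: (dist e v b) => [|[|n]]//=; last first.
      by move=> _; rewrite (@natrD _ 2 n); have := ler0n R n; lra.
    by move: b_v; rewrite (dist_eq0 conn dvb) eqxx.
  (* For a neighbour [a] of [v] the distance is odd, which suffices unless [a] is private and 3 is
     required. Distance 1 would then make [b] a second neighbour of [a] on the level of [v]. *)
  have := dist_parity a b; rewrite -side_vb eq_sym (sideP _ _ va) fNv//.
  case dab: (dist e a b) => [|[|[|n]]]//=.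
    case Ua: (private_child v a) => _; last by rewrite mulr0 add0r.
    have [z zb az] := dist_pred conn dab; rewrite -(dist_eq0 conn az) in zb.
    have /and3P[_ /eqP la /asboolP Uab] := Ua.
    have eba : e b a by rewrite e_sym.
    have /eqP := b_v; case; apply: Uab => //.
    have := level_edge yb; have := level_edge eba; lia.
  move=> _; rewrite (@natrD _ 3 n); have := ler0n R n.
  by case: private_child => /=; lra.
have := W1_ge (e := e) (@mu_ge0 R V e v) (@mu_ge0 R V e y) (@mu_eq0 R V e d reg v)
  (@mu_eq0 R V e d reg y) (sum_mu1 R e_irr reg d_gt0 v)
  (sum_mu1 R e_irr reg d_gt0 y) flip.
rewrite !(sum_mu e_irr reg) fv fy.
have -> : \sum_(w <- N v) f w = 2 * #|` private_children v|%:R.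
  rewrite -sum_nat_of_pred natr_sum mulr_sumr big_seq [RHS]big_seq.
  by apply: eq_bigr => w; rewrite (in_nbr reg) => /fNv.
have -> : \sum_(w <- N y) f w = 2 - d%:R.
  rewrite (big_fsetD1 v) ?(in_nbr reg)//= fv.
  have -> : \sum_(w <- (N y `\ v)%fset) f w = \sum_(w <- (N y `\ v)%fset) -1.
    rewrite big_seq [RHS]big_seq; apply: eq_bigr => w.
    rewrite in_fsetD1 (in_nbr reg) => /andP[/negPf wv /fNy ->].
    by rewrite wv mulr0 addr0.
  rewrite big_const_seq count_predT iter_addr addr0 mulNrn.
  have := cardfsD1 v (N y); rewrite (card_nbr reg) (in_nbr reg) yv => ->.
  by rewrite natrD /=; lra.
move: kvy; rewrite /kappa (dist_edge vy) divr1.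
have dR : 0 < d%:R :> R by rewrite ltr0n.
move: dR; set W := W1 _ _ _; set U := #|`private_children v|%:R.
set D := d%:R => D_gt0 kW WU.
have {}WU : D * (1 / 2 + 2 * U / (2 * D) - (0 / 2 + (2 - D) / (2 * D))) <= D * W.
  by rewrite ler_pM2l.
have E : D * (1 / 2 + 2 * U / (2 * D) - (0 / 2 + (2 - D) / (2 * D))) = D + U - 1.
  by field; rewrite gt_eqF.
have : D * k <= D * (1 - W) by rewrite ler_pM2l.
rewrite E in WU; lra.
Qed.

Lemma card_sphereS_le (i : nat) : (0 < i)%N ->
  (2 * #|` fset_set (sphere e x i.+1)| <=
   \sum_(v <- fset_set (sphere e x i)) (d.-1 + #|` private_children v|))%N.
Proof.
move=> i_gt0; set B := fset_set _; set A := fset_set _.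
have inA v : (v \in A) = (level v == i).
  rewrite in_fset_set; last exact: (finite_sphere (d := d)).
  by apply/idP/eqP; rewrite inE.
have inB v : (v \in B) = (level v == i.+1).
  rewrite in_fset_set; last exact: (finite_sphere (d := d)).
  by apply/idP/eqP; rewrite inE.
rewrite card_fset_sum1 big_distrr /= muln1.
(* Each [w] collects at least 2: from one parent if it is a private child, otherwise from two
   distinct parents. Exchanging the sums then counts by parents. *)
apply: (@leq_trans (\sum_(w <- B) \sum_(v <- A) (e v w + private_child v w))).
  rewrite big_seq [leqRHS]big_seq; apply: leq_sum => w; rewrite inB => /eqP lw.
  have [v vw lv] := dist_pred conn lw.
  have vA : v \in A by rewrite inA lv.
  rewrite (big_fsetD1 v)//= vw.
  case Uw : (private_child v w) => //; rewrite addn0.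
  have [v' [v'w lv' v'v]] : exists v', [/\ e v' w, level v' = level v & v' <> v].
    apply: contrapT => no_v'; move/negP: Uw; apply.
    rewrite /private_child vw lw lv eqxx /=; apply/asboolP => v' v'w lv'.
    by apply: contrapT => v'v; apply: no_v'; exists v'; rewrite lv' lv.
  rewrite (big_fsetD1 v') /= ?v'w ?addSn//.
  by rewrite in_fsetD1 inA lv' lv eqxx andbT; apply/eqP.
rewrite exchange_big /= big_seq [leqRHS]big_seq; apply: leq_sum => v.
rewrite inA => /eqP lv; rewrite big_split /= !sum_nat_of_pred leq_add//.
  (* As [i] is positive, [v] has a neighbour one level down, which leaves at most [d.-1] neighbours
     in the next sphere. *)
  have [y yv ly] : exists2 y, e y v & level y = i.-1.
    by apply: dist_pred => //; rewrite lv prednK.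
  have := cardfsD1 y (N v); rewrite (card_nbr reg) (in_nbr reg) e_sym yv => -> /=.
  apply: fsubset_leq_card; apply/fsubsetP => w.
  rewrite !inE /= -/B inB (in_nbr reg) => /andP[/eqP lw ->].
  by rewrite andbT; apply/eqP => wy; move: lw; rewrite wy; lia.
apply: fsubset_leq_card; apply/fsubsetP => w.
rewrite !inE /= => /andP[_ Uw]; rewrite Uw (in_nbr reg) andbT.
by case/and3P: Uw.
Qed.

End PrivateChildren.

Theorem theorem4p5 (R : realType) (V : choiceType) (e : rel V) (d : nat) (k : R)
    (e_sym : symmetric e) (e_irr : irreflexive e)
    (conn : connected_graph e) (reg : regular_graph e d)
    (bip : bipartite_graph e)
    (curv : forall v1 v2 : V, v1 <> v2 -> k <= kappa R e v1 v2)
    (x : V) (i : nat) (i_ge1 : (1 <= i)%N) :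
  #|` fset_set (sphere e x i.+1)|%:R
    <= (d%:R - d%:R * k) / 2 * #|` fset_set (sphere e x i)|%:R :> R.
Proof.
have := card_sphereS_le x e_sym conn reg i_ge1.
rewrite -(ler_nat R) natrM natr_sum; set B := #|` fset_set (sphere e x i.+1)|%:R => leB.
suff : 2 * B <= (d%:R - d%:R * k) * #|` fset_set (sphere e x i)|%:R by lra.
apply: le_trans leB _; rewrite -sum1_size natr_sum mulr_sumr.
rewrite big_seq [leRHS]big_seq; apply: ler_sum => v; rewrite mulr1.
rewrite in_fset_set; last exact: (finite_sphere (d := d)).
rewrite inE /= => xv.
have [y yv xy] : exists2 y, e y v & dist e x y = i.-1.
  by apply: dist_pred => //; rewrite xv prednK.
have v_y : v <> y by move=> vy; rewrite vy e_irr in yv.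
have lv : dist e x v = (dist e x y).+1 by rewrite xv xy prednK.
have := card_private_children e_sym e_irr conn reg bip yv lv (curv _ _ v_y).
(* Positivity makes the truncated [d.-1] equal to d - 1, so each summand is at most (d - 1) + (1 -
   dk) = d - dk. *)
have d_gt0 : (0 < d)%N.
  rewrite -(card_nbr reg y) cardfs_gt0; apply/fset0Pn; exists v.
  by rewrite (in_nbr reg).
have : d%:R = d.-1%:R + 1 :> R by rewrite natr1 prednK.
by rewrite natrD; lra.
Qed.
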